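(* Let $H$ be a closed subgroup of $\mathrm{GL}(n,\mathbb{R})$ that is transpose-invariant (i.e. $h^\top\in H$ for every $h\in H$), with Lie algebra $\mathfrak{h}\subset\mathfrak{gl}(n,\mathbb{R})$. Let $H$ be equipped with the left invariant Riemannian metric determined by the Frobenius inner product $\langle X,Y\rangle=\mathrm{tr}(X^\top Y)$ restricted to $\mathfrak{h}$, and let $R$ be the curvature tensor of $H$. Then for all $u,v\in\mathfrak{h}$, with $u_1=(u+u^\top)/2$, $u_2=(u-u^\top)/2$, $v_1=(v+v^\top)/2$, $v_2=(v-v^\top)/2$, $$\langle R(u,v)v,u\rangle=-2\|[u_1,v_1]\|^2+\frac14\|[u,v]\|^2+2\langle[u_1,v_1],[u_2,v_2]\rangle.$$
   Context: The bracket is the matrix commutator $[u,v]=uv-vu$, and $\|u\|=\langle u,u\rangle^{1/2}$. An element $u\in\mathfrak{h}$ is also identified with the left invariant vector field on $H$ whose value at the identity is $u$. $\nabla$ denotes the Levi-Civita connection of $H$; for left invariant fields $u,v,w\in\mathfrak{h}$ it is given by $\langle\nabla_uv,w\rangle=\frac12(\langle[u,v],w\rangle-\langle[v,w],u\rangle-\langle[u,w],v\rangle)$. The curvature tensor is $R(u,v)w=\nabla_u(\nabla_vw)-\nabla_v(\nabla_uw)-\nabla_{[u,v]}w$. *)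

(* Defs.v *)
From HB Require Import structures.
From mathcomp Require Import all_boot all_order all_algebra.
From mathcomp Require Import all_classical all_reals all_analysis.

Set Implicit Arguments.
Unset Strict Implicit.
Unset Printing Implicit Defensive.

Import Order.TTheory GRing.Theory Num.Theory.
Import numFieldNormedType.Exports.
Local Open Scope classical_set_scope.
Local Open Scope ring_scope.

(* "Closed" is meant in the subspace topology of GL(n, R), as usual for matrix
   groups: H need not be closed in the space of all matrices. *)
Record closed_subgroup_GL (R : realType) (n : nat) (H : set 'M[R]_n) : Prop :=
  ClosedSubgroupGL {
    csGL_closed : exists2 C : set 'M[R]_n,
      closed C & H = C `&` [set A | A \in unitmx] ;
    csGL_one : H 1%:M ;
    csGL_mul : forall A B, H A -> H B -> H (A *m B) ;
    csGL_inv : forall A, H A -> H (invmx A)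
  }.

Definition expmx (R : realType) (n : nat) (A : 'M[R]_n) : 'M[R]_n :=
  lim (series (fun k : nat => (k`!%:R)^-1 *: A ^+ k) @ \oo).

Definition lie_algebra (R : realType) (n : nat) (H : set 'M[R]_n) :
    set 'M[R]_n :=
  [set X | forall t : R, H (expmx (t *: X))].

Definition bracket (R : realType) (n : nat) (u v : 'M[R]_n) : 'M[R]_n :=
  u *m v - v *m u.

Definition frob (R : realType) (n : nat) (u v : 'M[R]_n) : R :=
  \tr (u^T *m v).

Definition frob_norm (R : realType) (n : nat) (u : 'M[R]_n) : R :=
  Num.sqrt (frob u u).

(* Elements of g stand for left invariant vector fields, so that only the terms
   of Koszul's formula that involve brackets remain.  For a Lie algebra g and
   u, v in g, there is exactly one z as below, because frob is an inner product
   on g; the default value 0 plays no role. *)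
Definition levi_civita (R : realType) (n : nat) (g : set 'M[R]_n)
    (u v : 'M[R]_n) : 'M[R]_n :=
  xget 0 [set z | g z /\ forall w, g w ->
    frob z w = 2^-1 * (frob (bracket u v) w - frob (bracket v w) u
                       - frob (bracket u w) v)].

Definition curvature (R : realType) (n : nat) (g : set 'M[R]_n)
    (u v w : 'M[R]_n) : 'M[R]_n :=
  levi_civita g u (levi_civita g v w) - levi_civita g v (levi_civita g u w)
  - levi_civita g (bracket u v) w.

Definition sym_part (R : realType) (n : nat) (u : 'M[R]_n) : 'M[R]_n :=
  2^-1 *: (u + u^T).

Definition skew_part (R : realType) (n : nat) (u : 'M[R]_n) : 'M[R]_n :=
  2^-1 *: (u - u^T).

(* Main.v *)
Require Import Defs.
From HB Require Import structures.
From mathcomp Require Import all_boot all_order all_algebra.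
From mathcomp Require Import all_classical all_reals all_analysis.
From mathcomp Require Import ring lra.

Import Order.TTheory GRing.Theory Num.Theory.
Import numFieldNormedType.Exports.
Local Open Scope classical_set_scope.
Local Open Scope ring_scope.

(* Let h be the Lie algebra of H.  If A_k in H and k (A_k - 1) tends to X, then
   A_k^k tends to exp X, which lies in H because H is closed in GL(n).  Applied
   to products, transposes, conjugates and limits of elements exp(X/k), this
   shows that h is a linear subspace closed under transposition and brackets.
   Hence Koszul's formula is solved within h by
     nabla_u v = ([u, v] + [u, v^T] - [u^T, v]) / 2.
   Write u = a + b and v = c + d with a, c symmetric and b, d skew.  As nabla_u
   is skew-adjoint, <R(u,v)v, u> becomes a quadratic expression in brackets of
   a, b, c, d, and its difference from the right-hand side vanishes by
     <[a,c], [b,d]> + <[a,d], [b,c]> + <[c,d], [a,b]> = 0,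
   which is the Jacobi identity for a, b, c paired with d. *)

Set Implicit Arguments.
Unset Strict Implicit.
Unset Printing Implicit Defensive.

(** Completeness is what lets [cvg_expmx] deduce convergence of a matrix series from convergence of
    its norms. *)
HB.instance Definition _ (R : realType) (m n : nat) :=
  Uniform_isComplete.Build 'M[R]_(m, n) (@cauchy_cvg 'M[R]_(m, n)).

(** * A submultiplicative matrix norm and limits of matrix sequences *)

Section MatrixNorm.
Variables (R : realType) (n : nat).
Implicit Types A B X : 'M[R]_n.

(* A rescaling of the entrywise maximum norm that makes it submultiplicative;
   the factor n.+1 rather than n keeps it a norm when n = 0. *)
Definition mnorm A : R := n.+1%:R * `|A|.

Lemma mnorm_ge0 A : 0 <= mnorm A.
Proof. by rewrite mulr_ge0. Qed.

Lemma mnormD A B : mnorm (A + B) <= mnorm A + mnorm B.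
Proof. by rewrite /mnorm -mulrDr ler_wpM2l// ler_normD. Qed.

Lemma mnormZ a A : mnorm (a *: A) = `|a| * mnorm A.
Proof. by rewrite /mnorm normrZ mulrCA. Qed.

Lemma mnormN A : mnorm (- A) = mnorm A.
Proof. by rewrite /mnorm normrN. Qed.

Lemma mnorm_sum (I : Type) (r : seq I) (P : pred I) (F : I -> 'M[R]_n) :
  mnorm (\sum_(i <- r | P i) F i) <= \sum_(i <- r | P i) mnorm (F i).
Proof. by rewrite /mnorm -mulr_sumr ler_wpM2l// ler_norm_sum. Qed.

Lemma norm_entry_le A i j : `|A i j| <= `|A|.
Proof. by rewrite [leRHS]mx_normrE (le_bigmax _ (fun ij => `|A ij.1 ij.2|) (i, j)). Qed.

Lemma mx_norm_leP A (c : R) : 0 <= c -> (forall i j, `|A i j| <= c) -> `|A| <= c.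
Proof. by move=> c0 Ac; rewrite [leLHS]mx_normrE; apply/bigmax_leP; split. Qed.

(** An entry of A B is a sum of n terms, each at most |A| |B|, and n <= n + 1. *)
Lemma mnormM A B : mnorm (A * B) <= mnorm A * mnorm B.
Proof.
rewrite /mnorm -mulrA ler_wpM2l// [leRHS]mulrCA.
apply: mx_norm_leP => [|i j]; first by rewrite !mulr_ge0.
rewrite mxE; apply: (le_trans (ler_norm_sum _ _ _)).
apply: (@le_trans _ _ (\sum_(k < n) `|A| * `|B|)).
  by apply: ler_sum => k _; rewrite normrM ler_pM// norm_entry_le.
rewrite sumr_const card_ord -[leLHS]mulr_natl.
by rewrite ler_wpM2r ?mulr_ge0// ler_nat.
Qed.

Lemma le_norm_mnorm A : `|A| <= mnorm A.
Proof. by rewrite ler_peMl// ler1n. Qed.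

(** Exponent 0 is excluded: for n > 0 the identity has [mnorm] n + 1, not 1. *)
Lemma mnormX A k : mnorm (A ^+ k.+1) <= mnorm A ^+ k.+1.
Proof.
elim: k => [|k IH]; first by rewrite !expr1.
by rewrite exprS [leRHS]exprS (le_trans (mnormM _ _))// ler_wpM2l ?mnorm_ge0.
Qed.

Lemma cvg_mnormP (F : nat -> 'M[R]_n) X :
  F @ \oo --> X <-> mnorm (F k - X) @[k --> \oo] --> (0 : R).
Proof.
split=> [FX|].
  rewrite (_ : 0 = n.+1%:R * `|X - X|); last by rewrite subrr normr0 mulr0.
  by apply: cvgMl_tmp; apply: cvg_norm; apply: cvgB => //; exact: cvg_cst.
move=> F0; apply/cvgrPdistC_lt => e e0.
move/cvgrPdist_lt : F0 => /(_ e e0); apply: filterS => k.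
rewrite sub0r normrN ger0_norm ?mnorm_ge0//.
exact/le_lt_trans/le_norm_mnorm.
Qed.

Lemma cvg_mulmx (F G : nat -> 'M[R]_n) A B :
  F @ \oo --> A -> G @ \oo --> B -> F k * G k @[k --> \oo] --> A * B.
Proof.
move=> FA GB; apply/cvg_mnormP.
have FAB : (mnorm (F k - A) * mnorm (G k) + mnorm A * mnorm (G k - B))
    @[k --> \oo] --> (0 : R).
  rewrite -[X in _ --> X]addr0 -[X in _ --> X + _](mul0r (mnorm B)).
  rewrite -[X in _ --> _ + X](mulr0 (mnorm A)).
  apply: cvgD; [apply: cvgM|apply: cvgMl_tmp].
  - exact/cvg_mnormP.
  - by apply: cvgMl_tmp; apply: cvg_norm.
  - exact/cvg_mnormP.
apply: squeeze_cvgr (cvg_cst 0) FAB; apply: nearW => k.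
rewrite mnorm_ge0/=.
have -> : F k * G k - A * B = (F k - A) * G k + A * (G k - B).
  by rewrite mulrBl mulrBr addrA subrK.
by rewrite (le_trans (mnormD _ _))// lerD ?mnormM.
Qed.

Lemma cvg_trmx (F : nat -> 'M[R]_n) A :
  F @ \oo --> A -> (F k)^T @[k --> \oo] --> A^T.
Proof.
move=> /cvg_mnormP FA; apply/cvg_mnormP; apply: squeeze_cvgr (cvg_cst 0) FA.
apply: nearW => k; rewrite mnorm_ge0/= ler_wpM2l//.
apply: mx_norm_leP => // i j.
by rewrite !mxE (le_trans _ (norm_entry_le _ j i))// !mxE.
Qed.

End MatrixNorm.

(** * Power estimates and the exponential series *)

Section MatrixExponential.
Variables (R : realType) (n : nat).
Implicit Types A B X Y : 'M[R]_n.

(** For A near 1 the factor 1 + a is close to 1, whereas [mnorm A] is close to n + 1 when n > 0 and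
    would ruin estimates of high powers. *)
Lemma mnormM_le1D A B (a : R) :
  mnorm (A - 1) <= a -> mnorm (A * B) <= (1 + a) * mnorm B.
Proof.
move=> Aa; have -> : A * B = B + (A - 1) * B by rewrite mulrBl mul1r addrC subrK.
rewrite (le_trans (mnormD _ _))// [leRHS]mulrDl mul1r lerD2l.
by rewrite (le_trans (mnormM _ _))// ler_wpM2r ?mnorm_ge0.
Qed.

Lemma mnormMr_le1D A B (a : R) :
  mnorm (B - 1) <= a -> mnorm (A * B) <= mnorm A * (1 + a).
Proof.
move=> Ba; have -> : A * B = A + A * (B - 1) by rewrite mulrBr mulr1 addrC subrK.
rewrite (le_trans (mnormD _ _))// [leRHS]mulrDr mulr1 lerD2l.
by rewrite (le_trans (mnormM _ _))// ler_wpM2l ?mnorm_ge0.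
Qed.

Lemma mnormMXr_le1D A B (a : R) k :
  mnorm (B - 1) <= a -> mnorm (A * B ^+ k) <= mnorm A * (1 + a) ^+ k.
Proof.
move=> Ba; have a0 : 0 <= a by exact: le_trans (mnorm_ge0 _) Ba.
elim: k => [|k IH]; first by rewrite !expr0 !mulr1.
rewrite !exprSr !mulrA (le_trans (mnormMr_le1D _ Ba))// ler_wpM2r//.
by rewrite addr_ge0.
Qed.

(** Telescoping through A^(k+1) - B^(k+1) = A (A^k - B^k) + (A - B) B^k. *)
Lemma mnorm_exprB A B (a : R) k :
  mnorm (A - 1) <= a -> mnorm (B - 1) <= a ->
  mnorm (A ^+ k - B ^+ k) <= k%:R * mnorm (A - B) * (1 + a) ^+ k.
Proof.
move=> Aa Ba; have a0 : 0 <= a by exact: le_trans (mnorm_ge0 _) Ba.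
elim: k => [|k IH]; first by rewrite !expr0 subrr /mnorm normr0 mulr0 !mul0r.
have -> : A ^+ k.+1 - B ^+ k.+1 = A * (A ^+ k - B ^+ k) + (A - B) * B ^+ k.
  by rewrite mulrBr mulrBl -!exprS addrA subrK.
apply: (le_trans (mnormD _ _)).
apply: (@le_trans _ _ ((1 + a) * (k%:R * mnorm (A - B) * (1 + a) ^+ k)
                       + mnorm (A - B) * (1 + a) ^+ k)).
  apply: lerD; last exact: mnormMXr_le1D.
  by rewrite (le_trans (mnormM_le1D _ Aa))// ler_wpM2l// addr_ge0.
rewrite -natr1 exprS.
(* This product is exactly the difference of the two sides. *)
have : 0 <= a * (mnorm (A - B) * (1 + a) ^+ k).
  by rewrite !mulr_ge0 ?mnorm_ge0// exprn_ge0// addr_ge0.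
by move=> H; lra.
Qed.

Lemma exprmxZ (c : R) X k : (c *: X) ^+ k = c ^+ k *: X ^+ k.
Proof.
elim: k => [|k IH]; first by rewrite !expr0 scale1r.
rewrite !exprS IH -[RHS]scalerA.
by rewrite -[LHS]/(c *: X *m (c ^+ k *: X ^+ k)) -scalemxAl -scalemxAr.
Qed.

Definition expmx_coeff X k : 'M[R]_n := (k`!%:R)^-1 *: X ^+ k.

(** The constant 1 + |1| covers k = 0, which [mnormX] leaves out. *)
Lemma norm_exprmx_le X k : `|X ^+ k| <= (1 + `|1 : 'M[R]_n|) * mnorm X ^+ k.
Proof.
case: k => [|k]; first by rewrite !expr0 mulr1 lerDr.
rewrite (le_trans (le_norm_mnorm _))// (le_trans (mnormX _ _))//.
by rewrite ler_peMl ?exprn_ge0 ?mnorm_ge0// lerDl.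
Qed.

(** Comparison with the real exponential series at [mnorm X]; hence the [lim] in [expmx] is a
    genuine limit. *)
Lemma cvg_expmx X : series (expmx_coeff X) @ \oo --> expmx X.
Proof.
apply: normed_cvg.
apply: (@series_le_cvg _ _ (fun k => (1 + `|1 : 'M[R]_n|) * exp_coeff (mnorm X) k)).
- by move=> k; rewrite normr_ge0.
- by move=> k; rewrite mulr_ge0 ?exp_coeff_ge0 ?mnorm_ge0// addr_ge0.
- move=> k; rewrite /= normrZ ger0_norm ?invr_ge0//.
  by rewrite /exp_coeff/= mulrA mulrC ler_wpM2r ?invr_ge0// norm_exprmx_le.
- have -> : series (fun k => (1 + `|1 : 'M[R]_n|) * exp_coeff (mnorm X) k) =
      (fun k => (1 + `|1 : 'M[R]_n|) * series (exp_coeff (mnorm X)) k).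
    by apply/funext => k; rewrite /series/= mulr_sumr.
  by apply: is_cvgMl_tmp; exact: is_cvg_series_exp_coeff.
Qed.

Lemma cvg_mnorm (F : nat -> 'M[R]_n) X :
  F @ \oo --> X -> mnorm (F k) @[k --> \oo] --> mnorm X.
Proof. by move=> FX; apply: cvgMl_tmp; exact: cvg_norm. Qed.

(** The terms of order at least 2 are compared one by one with those of the real series, and the
    bound passes to the limit. *)
Lemma mnorm_expmx_taylor1 X :
  mnorm (expmx X - 1 - X) <= expR (mnorm X) - 1 - mnorm X.
Proof.
have cl : mnorm (series (expmx_coeff X) k - 1 - X) @[k --> \oo] -->
    mnorm (expmx X - 1 - X).
  apply: cvg_mnorm; apply: cvgB; last exact: cvg_cst.
  by apply: cvgB; [exact: cvg_expmx|exact: cvg_cst].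
have cr : (series (exp_coeff (mnorm X)) k - 1 - mnorm X) @[k --> \oo] -->
    expR (mnorm X) - 1 - mnorm X.
  apply: cvgB; last exact: cvg_cst.
  by apply: cvgB; [exact: is_cvg_series_exp_coeff|exact: cvg_cst].
rewrite -(cvg_lim _ cl)// -(cvg_lim _ cr)//.
apply: ler_lim; [by apply/cvg_ex; eexists; exact: cl|
  by apply/cvg_ex; eexists; exact: cr|].
(* From index 2 on, a partial sum contains the terms of orders 0 and 1, which cancel. *)
exists 2%N => // -[|[|k]]// _ /=.
rewrite /series/= !big_nat_recl// /expmx_coeff /exp_coeff/=.
rewrite !expr0 !expr1 fact0 factS fact0 !muln1 !invr1 !scale1r !mulr1.
have cancel (V : zmodType) (a b c : V) : a + (b + c) - a - b = c.
  by rewrite (addrC a) addrK (addrC b) addrK.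
rewrite !cancel.
rewrite (le_trans (mnorm_sum _ _ _))// ler_sum// => i _.
rewrite mnormZ ger0_norm ?invr_ge0// mulrC.
by rewrite ler_wpM2r ?invr_ge0// mnormX.
Qed.

(** After clearing denominators: a falling factorial with j factors, each at most k + 1, is at most
    (k + 1)^j. *)
Lemma binomial_coef_le k j :
  'C(k.+1, j)%:R * (k.+1%:R^-1) ^+ j <= (j`!%:R)^-1 :> R.
Proof.
rewrite exprVn ler_pdivrMr ?exprn_gt0// mulrC ler_pdivlMr ?ltr0n ?fact_gt0//.
rewrite -natrX -natrM ler_nat bin_ffact.
elim: j => [|j IH]; first by rewrite ffactn0.
by rewrite ffactnSr expnSr leq_mul// leq_subr.
Qed.

(** Both sides are the same polynomial, at X and at [mnorm X]. Its coefficients 1/j! - C(k+1,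
    j)/(k+1)^j are nonnegative. Cutting the series at k + 2 matches the k + 2 terms of the binomial
    expansion. *)
Lemma mnorm_series_binomial X k :
  mnorm (series (expmx_coeff X) k.+2 - (1 + k.+1%:R^-1 *: X) ^+ k.+1) <=
  series (exp_coeff (mnorm X)) k.+2 - (1 + k.+1%:R^-1 * mnorm X) ^+ k.+1.
Proof.
rewrite /series/= !big_mkord ![1 + _]addrC !exprD1n -!sumrB.
rewrite (le_trans (mnorm_sum _ _ _))// ler_sum// => -[i ik] _ /=.
rewrite /expmx_coeff /exp_coeff/= [(_ *: X) ^+ i]exprmxZ [(_ * mnorm X) ^+ i]exprMn.
rewrite [(_ *: X ^+ i) *+ _]scalerMnl -[_ - _ *: X ^+ i]scalerBl -mulrnAl -[_ / _]mulrC.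
rewrite -mulrBl mnormZ ger0_norm.
  (* The coefficient of order 0 vanishes, so [mnormX] is called for positive exponents only. *)
  case: i ik => [|i] ik.
    rewrite fact0 invr1 !expr0 bin0 mulr1n subrr !mul0r//.
  by rewrite ler_wpM2l ?mnormX// subr_ge0 -mulr_natl binomial_coef_le.
by rewrite subr_ge0 -mulr_natl binomial_coef_le.
Qed.
End MatrixExponential.

(** * The exponential as a limit of powers, and its derivative at 0 *)

Section ExponentialLimits.
Variables (R : realType) (n : nat).
Implicit Types A B X Y : 'M[R]_n.

Lemma cvg_inv_natS : k.+1%:R^-1 @[k --> \oo] --> (0 : R).
Proof. exact: (@cvg_harmonic R). Qed.

(** Since exp(-x) >= 1 - x, the left side is at most 1/(1 - x) - 1 - x = x^2/(1 - x). *)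
Lemma expR_taylor1_le (x : R) :
  0 <= x -> x <= 2^-1 -> expR x - 1 - x <= 2 * x ^+ 2.
Proof.
move=> x0 x2.
have : expR x * (1 - x) <= 1.
  rewrite -[leRHS](expRxMexpNx_1 x) ler_wpM2l ?expR_ge0//.
  exact: expR_ge1Dx.
by move=> ?; have := expR_ge0 x; nra.
Qed.

(** With x = a/(k+1), the squeeze is exp(x/(1+x)) <= 1 + x <= exp x, raised to the power k + 1. The
    lower bound is exp(-y) >= 1 - y at y = x/(1+x). *)
Lemma cvg_expR_compound (a : R) : 0 <= a ->
  (1 + k.+1%:R^-1 * a) ^+ k.+1 @[k --> \oo] --> expR a.
Proof.
move=> a0.
have lower : expR (a / (1 + k.+1%:R^-1 * a)) @[k --> \oo] --> expR a.
  suff ca : a / (1 + k.+1%:R^-1 * a) @[k --> \oo] --> a.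
    exact: cvg_comp ca (continuous_expR (x := a)).
  rewrite -[X in _ --> X]mulr1; apply: cvgMl_tmp.
  rewrite -[X in _ --> X]invr1; apply: cvgV; first exact: oner_neq0.
  rewrite -[X in _ --> X]addr0; apply: cvgD; first exact: cvg_cst.
  rewrite -[X in _ --> X](mul0r a); apply: cvgMr_tmp; exact: cvg_inv_natS.
apply: squeeze_cvgr lower (cvg_cst (expR a)); apply: nearW => k.
have -> : a = k.+1%:R * (k.+1%:R^-1 * a) by rewrite mulVKf.
set x := k.+1%:R^-1 * a; have x0 : 0 <= x by rewrite mulr_ge0.
have x1p : 0 <= 1 + x by rewrite addr_ge0.
rewrite mulKf// -mulrA !expRM_natl; apply/andP; split; last first.
  by rewrite lerXn2r ?nnegrE ?expR_ge0// expR_ge1Dx.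
rewrite lerXn2r ?nnegrE ?expR_ge0//.
have x1 : 1 + x != 0 by rewrite gt_eqF// ltr_wpDr.
rewrite -[leRHS]invrK -[leLHS]invrK lef_pV2 ?posrE ?invr_gt0 ?expR_gt0 ?ltr_wpDr//.
rewrite -expRN (le_trans _ (expR_ge1Dx _))// le_eqVlt; apply/orP; left; apply/eqP.
by field.
Qed.

(** The distance from the power to the partial sum is dominated by its scalar analogue, in which
    both terms tend to exp([mnorm X]). *)
Lemma cvg_expmx_compound X :
  (1 + k.+1%:R^-1 *: X) ^+ k.+1 @[k --> \oo] --> expmx X.
Proof.
apply/cvg_mnormP.
have S : (fun k => series (expmx_coeff X) k.+2) @ \oo --> expmx X.
  rewrite (cvg_shiftS (fun k => series (expmx_coeff X) k.+1)).
  by rewrite (cvg_shiftS (series (expmx_coeff X))); exact: cvg_expmx.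
have s : series (exp_coeff (mnorm X)) k.+2 @[k --> \oo] --> expR (mnorm X).
  rewrite (cvg_shiftS (fun k => series (exp_coeff (mnorm X)) k.+1)).
  rewrite (cvg_shiftS (series (exp_coeff (mnorm X)))).
  exact: is_cvg_series_exp_coeff.
have U : ((series (exp_coeff (mnorm X)) k.+2 - (1 + k.+1%:R^-1 * mnorm X) ^+ k.+1)
   + mnorm (series (expmx_coeff X) k.+2 - expmx X)) @[k --> \oo] --> (0 : R).
  rewrite -[X in _ --> X]addr0 -[X in _ --> X + _](subrr (expR (mnorm X))).
  apply: cvgD; last exact/cvg_mnormP.
  by apply: cvgB => //; apply: cvg_expR_compound; exact: mnorm_ge0.
apply: squeeze_cvgr (cvg_cst 0) U; apply: nearW => k.
rewrite mnorm_ge0/=; set P := _ ^+ _; set S' := series (expmx_coeff X) k.+2.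
have -> : P - expmx X = - (S' - P) + (S' - expmx X).
  by rewrite opprB addrA subrK.
rewrite (le_trans (mnormD _ _))// lerD2r mnormN.
exact: mnorm_series_binomial.
Qed.


(** [mnorm_exprB] compares F k with 1 + X/(k+1). The growth factor is at most (1 + M/(k+1))^(k+1) <=
    exp M, and the other factor is the distance from (k+1)(F k - 1) to X. *)
Lemma cvg_expmx_tangent (F : nat -> 'M[R]_n) X :
  k.+1%:R *: (F k - 1) @[k --> \oo] --> X ->
  F k ^+ k.+1 @[k --> \oo] --> expmx X.
Proof.
move=> FX; apply/cvg_mnormP.
set E := fun k => (1 + k.+1%:R^-1 *: X) ^+ k.+1.
have EX : mnorm (E k - expmx X) @[k --> \oo] --> (0 : R).
  exact/cvg_mnormP/cvg_expmx_compound.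
(* Being larger than [mnorm X], M eventually bounds (k+1)(F k - 1) as well as X. *)
pose M := mnorm X + 1.
have U : (mnorm (k.+1%:R *: (F k - 1) - X) * expR M + mnorm (E k - expmx X))
    @[k --> \oo] --> (0 : R).
  rewrite -[X in _ --> X]addr0 -[X in _ --> X + _](mul0r (expR M)).
  by apply: cvgD => //; apply: cvgMr_tmp; exact/cvg_mnormP.
apply: squeeze_cvgr (cvg_cst 0) U.
have FM : \forall k \near \oo, mnorm (k.+1%:R *: (F k - 1)) <= M.
  by apply: cvgr_le (cvg_mnorm FX) _ _; rewrite ltrDl.
apply: filterS FM => k FM; rewrite mnorm_ge0/=.
have -> : F k ^+ k.+1 - expmx X = (F k ^+ k.+1 - E k) + (E k - expmx X).
  by rewrite addrA subrK.
rewrite (le_trans (mnormD _ _))// lerD2r.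
have M0 : 0 <= M by rewrite addr_ge0 ?mnorm_ge0.
have scal Y : mnorm Y = k.+1%:R^-1 * mnorm (k.+1%:R *: Y).
  by rewrite mnormZ ger0_norm// mulKf.
apply: (le_trans (mnorm_exprB _ (a := k.+1%:R^-1 * M) _ _)).
- by rewrite scal ler_wpM2l.
- rewrite addrAC subrr add0r mnormZ ger0_norm ?invr_ge0//.
  by rewrite ler_wpM2l// lerDl.
have -> : k.+1%:R * mnorm (F k - (1 + k.+1%:R^-1 *: X)) = mnorm (k.+1%:R *: (F k - 1) - X).
  rewrite scal mulVKf//; congr mnorm.
  by rewrite opprD addrA scalerBr scalerA divff// scale1r.
rewrite ler_wpM2l ?mnorm_ge0//.
have -> : expR M = expR (k.+1%:R^-1 * M) ^+ k.+1 by rewrite -expRM_natl mulVKf.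
by rewrite lerXn2r ?nnegrE ?addr_ge0 ?mulr_ge0 ?expR_ge0// expR_ge1Dx.
Qed.

Lemma cvg_mx_unique (F : nat -> 'M[R]_n) X Y :
  F @ \oo --> X -> F @ \oo --> Y -> X = Y.
Proof. by move=> FX FY; rewrite -(cvg_lim _ FX)// (cvg_lim _ FY). Qed.

(** The constant sequence 1 has tangent 0. *)
Lemma expmx0 : expmx 0 = 1 :> 'M[R]_n.
Proof.
apply: (@cvg_mx_unique (fun=> 1)); last exact: cvg_cst.
rewrite (_ : (fun=> 1) = (fun k => (fun=> 1) k ^+ k.+1)); last first.
  by apply/funext => k; rewrite expr1n.
apply: cvg_expmx_tangent; rewrite (_ : (fun _ => _) = cst 0); first exact: cvg_cst.
by apply/funext => k; rewrite subrr scaler0.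
Qed.

(* (1 + X/k)^k (1 - X/k)^k = (1 - X^2/k^2)^k, and k (X^2/k^2) tends to 0. *)
Lemma expmxMN X : expmx X * expmx (- X) = 1.
Proof.
apply: (cvg_mx_unique (cvg_mulmx (@cvg_expmx_compound X) (@cvg_expmx_compound (- X)))).
rewrite -[X in _ --> X]expmx0 (_ : (fun _ => _) =
  (fun k => (1 - (k.+1%:R^-1 ^+ 2) *: X ^+ 2) ^+ k.+1)); last first.
  apply/funext => k; rewrite scalerN -exprmxZ.
  set Y := _ *: X; rewrite -exprMn_comm; last first.
        apply: commrB; first exact: commr1.
    by apply/commr_sym; apply: commrD; [exact: commr1|].
  by rewrite mulrDl mul1r mulrDr mulr1 mulrN expr2 addrA subrK.
apply: cvg_expmx_tangent.
rewrite (_ : (fun _ => _) = (fun k => k.+1%:R^-1 *: (- X ^+ 2))).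
  rewrite -[X in _ --> X](scale0r (- X ^+ 2)); apply: cvgZr_tmp.
  exact: cvg_inv_natS.
apply/funext => k; rewrite addrAC subrr add0r scalerN scalerN scalerA.
by rewrite (expr2 k.+1%:R^-1) mulVKf.
Qed.

(** The remainder is at most (k+1) * 2 * ([mnorm (F k)]/(k+1))^2, which tends to 0. The argument F k
    varies with k because [lie_algebra_limit] needs it. *)
Lemma cvg_expmx_derivative (F : nat -> 'M[R]_n) X : F @ \oo --> X ->
  k.+1%:R *: (expmx (k.+1%:R^-1 *: F k) - 1) @[k --> \oo] --> X.
Proof.
move=> FX; apply/cvg_mnormP.
have small : (mnorm (F k) * k.+1%:R^-1) @[k --> \oo] --> (0 : R).
  rewrite -[X in _ --> X](mulr0 (mnorm X)).
  by apply: cvgM; [exact: cvg_mnorm|exact: cvg_inv_natS].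
have U : (2 * mnorm (F k) * (mnorm (F k) * k.+1%:R^-1) + mnorm (F k - X))
    @[k --> \oo] --> (0 : R).
  rewrite -[X in _ --> X]addr0 -[X in _ --> X + _](mulr0 (2 * mnorm X)).
  apply: cvgD; last exact/cvg_mnormP.
  by apply: cvgM => //; apply: cvgMl_tmp; exact: cvg_mnorm.
apply: squeeze_cvgr (cvg_cst 0) U.
(* The bound 1/2 is the range in which [expR_taylor1_le] applies. *)
have : \forall k \near \oo, mnorm (F k) * k.+1%:R^-1 <= 2^-1.
  by apply: cvgr_le small _ _; rewrite invr_gt0.
apply: filterS => k Fk; rewrite mnorm_ge0/=.
have -> : k.+1%:R *: (expmx (k.+1%:R^-1 *: F k) - 1) - X =
  k.+1%:R *: (expmx (k.+1%:R^-1 *: F k) - 1 - k.+1%:R^-1 *: F k) + (F k - X).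
  by rewrite [in RHS]scalerBr scalerA divff// scale1r addrA subrK.
rewrite (le_trans (mnormD _ _))// lerD2r mnormZ ger0_norm//.
rewrite mulrC -ler_pdivlMr// (le_trans (mnorm_expmx_taylor1 _))//.
rewrite mnormZ ger0_norm ?invr_ge0// [_^-1 * _]mulrC.
rewrite (le_trans (expR_taylor1_le _ _))//.
  by rewrite mulr_ge0 ?mnorm_ge0 ?invr_ge0.
by rewrite expr2 le_eqVlt; apply/orP; left; apply/eqP; ring.
Qed.
End ExponentialLimits.

(** * Closure properties of the Lie algebra of a closed subgroup *)

Section LieAlgebraOfClosedSubgroup.
Variables (R : realType) (n : nat) (H : set 'M[R]_n).
Hypothesis closedH : closed_subgroup_GL H.
Implicit Types A B X Y : 'M[R]_n.
Let h := lie_algebra H.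

Lemma expmx_unit X : expmx X \in unitmx.
Proof. by case: (mulmx1_unit (expmxMN X)). Qed.

Lemma subgroup_expr A k : H A -> H (A ^+ k).
Proof.
move=> HA; elim: k => [|k IH]; first exact: csGL_one closedH.
by rewrite exprS; exact: (csGL_mul closedH).
Qed.

(** As H is closed only relative to GL(n), the limit must be known to be invertible; exponentials
    are. *)
Lemma subgroup_limit_expmx (F : nat -> 'M[R]_n) X :
  (forall k, H (F k)) -> F @ \oo --> expmx X -> H (expmx X).
Proof.
have [C clC HC] := csGL_closed closedH; move=> HF FX.
rewrite HC; split; last exact: expmx_unit.
apply: (@closed_cvg _ _ _ _ F C clC _ _ FX); apply: nearW => k.
by have := HF k; rewrite HC => -[].
Qed.

(** The criterion behind the closure properties below: the powers F t k ^ (k+1) stay in H and tend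
    to exp(tX). *)
Lemma tangent_lie_algebra (F : R -> nat -> 'M[R]_n) X :
  (forall t k, H (F t k)) ->
  (forall t, k.+1%:R *: (F t k - 1) @[k --> \oo] --> t *: X) -> h X.
Proof.
move=> HF FX t.
apply: (@subgroup_limit_expmx (fun k => F t k ^+ k.+1)); last exact: cvg_expmx_tangent.
by move=> k; exact: subgroup_expr.
Qed.

Lemma lie_algebraZ (a : R) X : h X -> h (a *: X).
Proof. by move=> hX t; rewrite scalerA; exact: hX. Qed.

Lemma lie_algebra_limit (F : nat -> 'M[R]_n) X :
  (forall k, h (F k)) -> F @ \oo --> X -> h X.
Proof.
move=> hF FX.
apply: (@tangent_lie_algebra (fun t k => expmx (k.+1%:R^-1 *: (t *: F k)))).
  by move=> t k; apply: lie_algebraZ (hF k) _.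
by move=> t; apply: cvg_expmx_derivative; exact: cvgZl_tmp.
Qed.

(** exp(X/(k+1)) is 1 plus 1/(k+1) times a convergent difference quotient. *)
Lemma cvg_expmx_inv_natS X : expmx (k.+1%:R^-1 *: X) @[k --> \oo] --> (1 : 'M[R]_n).
Proof.
suff: expmx (k.+1%:R^-1 *: X) @[k --> \oo] --> 1 + 0 *: X.
  by rewrite scale0r addr0.
rewrite (_ : (fun _ => _) = fun k =>
  1 + k.+1%:R^-1 *: (k.+1%:R *: (expmx (k.+1%:R^-1 *: X) - 1))).
  apply: cvgD; first exact: cvg_cst.
  apply: cvgZ; first exact: cvg_inv_natS.
  by apply: cvg_expmx_derivative; exact: cvg_cst.
by apply/funext => k; rewrite scalerA mulVf// scale1r addrC subrK.
Qed.

Lemma lie_algebraD X Y : h X -> h Y -> h (X + Y).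
Proof.
move=> hX hY.
apply: (@tangent_lie_algebra (fun t k =>
  expmx (k.+1%:R^-1 *: (t *: X)) * expmx (k.+1%:R^-1 *: (t *: Y)))) => [t k|t].
  by apply: (csGL_mul closedH); [exact: lie_algebraZ|exact: lie_algebraZ].
(* Product rule A B - 1 = (A - 1) B + (B - 1); the inserted factor 1 is the limit of B. *)
rewrite (_ : t *: (X + Y) = t *: X * 1 + t *: Y); last by rewrite mulr1 scalerDr.
rewrite (_ : (fun _ => _) = (fun k =>
  k.+1%:R *: (expmx (k.+1%:R^-1 *: (t *: X)) - 1) * expmx (k.+1%:R^-1 *: (t *: Y))
  + k.+1%:R *: (expmx (k.+1%:R^-1 *: (t *: Y)) - 1))).
  apply: cvgD; last by apply: cvg_expmx_derivative; exact: cvg_cst.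
  apply: cvg_mulmx; last exact: cvg_expmx_inv_natS.
  by apply: cvg_expmx_derivative; exact: cvg_cst.
apply/funext => k; set A := expmx _; set B := expmx _.
rewrite -[_ *: (A - 1) * B]/(_ *: (A - 1) *m B) -scalemxAl -scalerDr.
by rewrite -[_ *m _]/((A - 1) * B) mulrBl mul1r addrA subrK.
Qed.

Lemma lie_algebraN X : h X -> h (- X).
Proof. by rewrite -scaleN1r; exact: lie_algebraZ. Qed.

Lemma lie_algebraB X Y : h X -> h Y -> h (X - Y).
Proof. by move=> hX hY; apply: lie_algebraD => //; exact: lie_algebraN. Qed.

(** Conjugating exp(tY/(k+1)) by exp X conjugates its tangent, because exp X exp(-X) = 1. *)
Lemma lie_algebra_conj X Y : h X -> h Y -> h (expmx X * Y * expmx (- X)).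
Proof.
move=> hX hY.
have HX : H (expmx X) by rewrite -[X]scale1r; exact: hX.
have HNX : H (expmx (- X)) by rewrite -scaleN1r; exact: hX.
apply: (@tangent_lie_algebra (fun t k =>
  expmx X * expmx (k.+1%:R^-1 *: (t *: Y)) * expmx (- X))) => [t k|t].
  apply: (csGL_mul closedH) => //; apply: (csGL_mul closedH) => //.
  exact: lie_algebraZ.
rewrite (_ : t *: (expmx X * Y * expmx (- X)) = expmx X * (t *: Y) * expmx (- X)); last first.
  by rewrite -[LHS]/(t *: (expmx X *m Y *m expmx (- X))) scalemxAl scalemxAr.
rewrite (_ : (fun _ => _) = (fun k => expmx X *
  (k.+1%:R *: (expmx (k.+1%:R^-1 *: (t *: Y)) - 1)) * expmx (- X))).
  apply: cvg_mulmx; last exact: cvg_cst.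
  apply: cvg_mulmx; first exact: cvg_cst.
  by apply: cvg_expmx_derivative; exact: cvg_cst.
apply/funext => k; set A := expmx (_ *: _).
rewrite -[RHS]/(_ *m (_ *: (A - 1)) *m _) -scalemxAr -scalemxAl.
rewrite -[_ *m (A - 1) *m _]/(_ * (A - 1) * _) mulrBr mulr1 mulrBl.
by rewrite expmxMN.
Qed.

(* The bracket is the derivative at 0 of s |-> exp(sX) Y exp(-sX). *)
Lemma lie_algebra_bracket X Y : h X -> h Y -> h (bracket X Y).
Proof.
move=> hX hY.
pose g k := expmx (k.+1%:R^-1 *: X); pose g' k := expmx (k.+1%:R^-1 *: (- X)).
apply: (@lie_algebra_limit (fun k => k.+1%:R *: (g k * Y * g' k - Y))).
  move=> k; apply: lie_algebraZ; apply: lie_algebraB => //.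
  by rewrite /g' scalerN; apply: lie_algebra_conj => //; exact: lie_algebraZ.
(* Product rule g Y g' - Y = (g - 1) Y g' + Y (g' - 1); the factor 1 is the limit of g'. *)
rewrite (_ : bracket X Y = X * Y * 1 + Y * (- X)); last by rewrite mulr1 mulrN.
rewrite (_ : (fun _ => _) = (fun k =>
  k.+1%:R *: (g k - 1) * Y * g' k + Y * (k.+1%:R *: (g' k - 1)))).
  apply: cvgD.
    apply: cvg_mulmx; last exact: cvg_expmx_inv_natS.
    apply: cvg_mulmx; last exact: cvg_cst.
    by apply: cvg_expmx_derivative; exact: cvg_cst.
  apply: cvg_mulmx; first exact: cvg_cst.
  by apply: cvg_expmx_derivative; exact: cvg_cst.
apply/funext => k.
rewrite -[RHS]/(_ *: (g k - 1) *m Y *m g' k + Y *m (_ *: (g' k - 1))).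
rewrite -!scalemxAl -scalemxAr -scalerDr; congr (_ *: _).
rewrite -[RHS]/((g k - 1) * Y * g' k + Y * (g' k - 1)).
by rewrite !mulrBl mul1r mulrBr mulr1 addrA subrK.
Qed.

(** The transposes of exp(tX/(k+1)) lie in H and have tangent t X^T. *)
Lemma lie_algebra_tr X : (forall A, H A -> H A^T) -> h X -> h X^T.
Proof.
move=> trH hX.
apply: (@tangent_lie_algebra (fun t k => (expmx (k.+1%:R^-1 *: (t *: X)))^T)) => [t k|t].
  by apply: trH; exact: lie_algebraZ.
rewrite -linearZ/= (_ : (fun _ => _) = (fun k =>
  (k.+1%:R *: (expmx (k.+1%:R^-1 *: (t *: X)) - 1))^T)).
  by apply: cvg_trmx; apply: cvg_expmx_derivative; exact: cvg_cst.
apply/funext => k; rewrite [RHS]linearZ/=; congr (_ *: _).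
by rewrite raddfB/=; congr (_ - _); apply/esym; exact: trmx1.
Qed.

End LieAlgebraOfClosedSubgroup.

(** * Frobenius product, brackets and the explicit connection *)

Section FrobeniusBracket.
Variables (R : realType) (n : nat).
Implicit Types u v w x y z : 'M[R]_n.

Lemma frobC u v : frob u v = frob v u.
Proof. by rewrite /frob -mxtrace_tr trmx_mul trmxK. Qed.

Lemma frobDr u v w : frob u (v + w) = frob u v + frob u w.
Proof. by rewrite /frob mulmxDr raddfD. Qed.

Lemma frobDl u v w : frob (v + w) u = frob v u + frob w u.
Proof. by rewrite !(frobC _ u) frobDr. Qed.

Lemma frobZr (k : R) u v : frob u (k *: v) = k * frob u v.
Proof. by rewrite /frob -scalemxAr linearZ. Qed.

Lemma frobZl (k : R) u v : frob (k *: u) v = k * frob u v.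
Proof. by rewrite frobC frobZr frobC. Qed.

Lemma frobNr u v : frob u (- v) = - frob u v.
Proof. by rewrite -scaleN1r frobZr mulN1r. Qed.

Lemma frobNl u v : frob (- u) v = - frob u v.
Proof. by rewrite frobC frobNr frobC. Qed.

Lemma frob_sum_sqr u : frob u u = \sum_i \sum_j u j i ^+ 2.
Proof.
rewrite /frob /mxtrace; apply: eq_bigr => i _; rewrite mxE.
by apply: eq_bigr => j _; rewrite !mxE expr2.
Qed.

Lemma frob_ge0 u : 0 <= frob u u.
Proof. by rewrite frob_sum_sqr; do 2!apply: sumr_ge0 => ? _; exact: sqr_ge0. Qed.

Lemma frob_eq0 u : frob u u = 0 -> u = 0.
Proof.
rewrite frob_sum_sqr => /eqP.
rewrite psumr_eq0 => [/allP u0|i _]; last by apply: sumr_ge0 => ? _; exact: sqr_ge0.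
apply/matrixP => j i; rewrite mxE; apply/eqP.
have /(_ (mem_index_enum _)) := u0 i.
rewrite psumr_eq0 => [/allP /(_ j (mem_index_enum _))|? _]; last exact: sqr_ge0.
by rewrite sqrf_eq0.
Qed.

Lemma frob_norm_sqr u : frob_norm u ^+ 2 = frob u u.
Proof. by rewrite sqr_sqrtr// frob_ge0. Qed.

Lemma frob_sym_skew u v : u^T = u -> v^T = - v -> frob u v = 0.
Proof.
move=> uT vT; have : frob u v = - frob u v.
  by rewrite {1}frobC /frob uT vT mulNmx raddfN/= mxtrace_mulC.
by move=> ?; lra.
Qed.

Lemma bracketDl u v w : bracket (u + v) w = bracket u w + bracket v w.
Proof. by rewrite /bracket mulmxDl mulmxDr opprD addrACA. Qed.

Lemma bracketNr u v : bracket u (- v) = - bracket u v.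
Proof. by rewrite /bracket mulmxN mulNmx opprB opprK addrC. Qed.

Lemma bracketC u v : bracket u v = - bracket v u.
Proof. by rewrite /bracket opprB. Qed.

Lemma bracketvv u : bracket u u = 0.
Proof. exact: subrr. Qed.

Lemma bracketDr u v w : bracket u (v + w) = bracket u v + bracket u w.
Proof. by rewrite bracketC bracketDl opprD -!bracketC. Qed.

Lemma bracketNl u v : bracket (- u) v = - bracket u v.
Proof. by rewrite bracketC bracketNr -bracketC. Qed.

Lemma tr_bracket u v : (bracket u v)^T = bracket v^T u^T.
Proof. by rewrite /bracket raddfB/= !trmx_mul. Qed.

Lemma bracket_jacobi u v w :
  bracket u (bracket v w) + bracket v (bracket w u) + bracket w (bracket u v) = 0.
Proof.
rewrite /bracket !mulmxBl !mulmxBr !mulmxA.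
move: (u *m v *m w) (u *m w *m v) (v *m u *m w) (v *m w *m u) (w *m u *m v)
  (w *m v *m u) => A B C D E F.
by apply/matrixP => i j; rewrite !mxE; ring.
Qed.

(** The adjoint of ad u is ad u^T, by cyclicity of the trace. *)
Lemma frob_bracketl u v w : frob (bracket u v) w = frob v (bracket u^T w).
Proof.
rewrite /frob tr_bracket /bracket mulmxBl mulmxBr !raddfB/= !mulmxA.
by rewrite -[u^T *m v^T *m w]mulmxA [in X in _ - X = _]mxtrace_mulC.
Qed.

Definition koszul u v : 'M[R]_n :=
  2^-1 *: (bracket u v + bracket u v^T - bracket u^T v).

(** The adjunction [frob_bracketl] frees w from the brackets on the right. *)
Lemma frob_koszul u v w : frob (koszul u v) w =
  2^-1 * (frob (bracket u v) w - frob (bracket v w) u - frob (bracket u w) v).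
Proof.
rewrite (frob_bracketl v w) (frob_bracketl u w) (bracketC v^T u) frobNr opprK.
by rewrite /koszul frobZl frobDl frobNl frobDl !(frobC w).
Qed.

(** Metric compatibility: the right side of Koszul's formula changes sign when v and w are
    exchanged. *)
Lemma frob_koszul_skew u v w : frob (koszul u v) w = - frob v (koszul u w).
Proof. by rewrite (frobC v) !frob_koszul (bracketC w v) frobNl; lra. Qed.

Lemma levi_civitaE (g : set 'M[R]_n) u v :
  (forall x y, g x -> g y -> g (x - y)) ->
  g (koszul u v) -> levi_civita g u v = koszul u v.
Proof.
move=> gB guv; rewrite /levi_civita; case: xgetP => [z _ [gz zE]|/(_ (koszul u v))].
  (* Uniqueness: the difference of two solutions lies in g, so it may be used as the test vector w
     and is orthogonal to itself. *)
  apply/eqP; rewrite -subr_eq0; apply/eqP/frob_eq0.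
  rewrite frobDl frobNl zE ?frob_koszul; last exact: gB.
  by rewrite subrr.
by case; split=> // w _; rewrite frob_koszul.
Qed.

Lemma sym_partT u : (sym_part u)^T = sym_part u.
Proof. by rewrite /sym_part linearZ/= raddfD/= trmxK addrC. Qed.

Lemma skew_partT u : (skew_part u)^T = - skew_part u.
Proof. by rewrite /skew_part linearZ/= raddfB/= trmxK -scalerN opprB. Qed.

Lemma sym_skew_partK u : sym_part u + skew_part u = u.
Proof. by apply/matrixP => i j; rewrite !mxE; field. Qed.

Lemma curvature_koszul u v :
  let u1 := sym_part u in let u2 := skew_part u in
  let v1 := sym_part v in let v2 := skew_part v in
  frob (koszul u (koszul v v) - koszul v (koszul u v) - koszul (bracket u v) v) u =
    - 2 * frob (bracket u1 v1) (bracket u1 v1)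
    + 4^-1 * frob (bracket u v) (bracket u v)
    + 2 * frob (bracket u1 v1) (bracket u2 v2).
Proof.
move=> a b c d.
have [aT cT] : a^T = a /\ c^T = c by rewrite !sym_partT.
have [bT dT] : b^T = - b /\ d^T = - d by rewrite !skew_partT.
have uE : u = a + b by rewrite sym_skew_partK.
have vE : v = c + d by rewrite sym_skew_partK.
have uT : u^T = a - b by rewrite uE raddfD/= aT bT.
have vT : v^T = c - d by rewrite vE raddfD/= cT dT.
have key : frob (bracket a c) (bracket b d) + frob (bracket a d) (bracket b c)
    + frob (bracket c d) (bracket a b) = 0.
  have := congr1 (frob d) (bracket_jacobi a b c).
  rewrite 2!frobDr (bracketC c a) bracketNr frobNr.
  rewrite (frobC (bracket a c)) !(frob_bracketl _ d) aT bT cT bracketNl frobNr.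
  by rewrite /frob mulmx0 mxtrace0 => ?; lra.
(* Brackets of two symmetric or two skew parts are skew, mixed ones are symmetric; the two kinds are
   therefore orthogonal. *)
have pT : (bracket a c)^T = - bracket a c by rewrite tr_bracket aT cT bracketC.
have qT : (bracket b d)^T = - bracket b d.
  by rewrite tr_bracket bT dT bracketNl bracketNr opprK bracketC.
have rT : (bracket a d)^T = bracket a d by rewrite tr_bracket aT dT bracketNl -bracketC.
have sT : (bracket b c)^T = bracket b c by rewrite tr_bracket bT cT bracketNr -bracketC.
have w_frob : frob (koszul (bracket u v) v) u = 2^-1 *
    (frob (bracket u v) (bracket u v)
     + frob (bracket u v) (bracket u v^T + bracket u^T v)).
  have f1 w : frob (bracket w v) u = frob w (bracket u v^T).
    by rewrite (bracketC w v) frobNl frob_bracketl (bracketC v^T u) frobNr opprK.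
  have f2 w : frob (bracket w u) v = - frob w (bracket u^T v).
    by rewrite (bracketC w u) frobNl frob_bracketl.
  by rewrite frob_koszul f1 f2 (bracketC v u) frobNl frobDr; ring.
have brE : bracket u v = bracket a c + bracket b d + bracket a d + bracket b c.
  rewrite uE vE bracketDl !bracketDr.
  move: (bracket a c) (bracket b d) (bracket a d) (bracket b c) => p q r s.
  by apply/matrixP => i j; rewrite !mxE; ring.
have brTE : bracket u v^T + bracket u^T v = 2%:R *: (bracket a c - bracket b d).
  rewrite uT vT uE vE !bracketDl !bracketDr !bracketNl !bracketNr.
  move: (bracket a c) (bracket b d) (bracket a d) (bracket b c) => p q r s.
  by apply/matrixP => i j; rewrite !mxE; ring.
have kuv : koszul u v =
    2^-1 *: (bracket a c + bracket b d + 3%:R *: bracket b c - bracket a d).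
  rewrite /koszul uT vT uE vE !bracketDl !bracketDr !bracketNl !bracketNr.
  move: (bracket a c) (bracket b d) (bracket a d) (bracket b c) => p q r s.
  by apply/matrixP => i j; rewrite !mxE; ring.
have kvu : koszul v u =
    2^-1 *: (bracket b c - bracket a c - bracket b d - 3%:R *: bracket a d).
  rewrite /koszul uT vT uE vE !bracketDl !bracketDr !bracketNl !bracketNr.
  rewrite (bracketC c a) (bracketC c b) (bracketC d a) (bracketC d b).
  move: (bracket a c) (bracket b d) (bracket a d) (bracket b c) => p q r s.
  by apply/matrixP => i j; rewrite !mxE; ring.
(* On the diagonal the connection reduces to [z, z^T], and [x + y, x - y] = -2 [x, y]. *)
have koszulDD (x y : 'M[R]_n) (z := x + y) :
    z^T = x - y -> koszul z z = - 2%:R *: bracket x y.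
  move=> zT; rewrite /koszul zT /z !bracketDl !bracketDr !bracketNl !bracketNr.
  rewrite (bracketC y x) !bracketvv.
  move: (bracket x y) => p.
  by apply/matrixP => i j; rewrite !mxE; field.
have kuu : koszul u u = - 2%:R *: bracket a b by rewrite uE koszulDD// -uE.
have kvv : koszul v v = - 2%:R *: bracket c d by rewrite vE koszulDD// -vE.
(* Skew-adjointness turns the second-order terms into -<nabla_v v, nabla_u u> + <nabla_u v, nabla_v
   u>. *)
rewrite 2!frobDl 2!frobNl (frob_koszul_skew u (koszul v v) u).
rewrite (frob_koszul_skew v (koszul u v) u).
rewrite w_frob brE brTE kuv kvu kuu kvv.
have rp := frob_sym_skew rT pT; have rq := frob_sym_skew rT qT.
have sp := frob_sym_skew sT pT; have sq := frob_sym_skew sT qT.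
(* The six brackets become arbitrary matrices, bound only by [key] and the four orthogonality
   relations. *)
move: (bracket a c) (bracket b d) (bracket a d) (bracket b c) (bracket a b)
  (bracket c d) key rp rq sp sq => p q r s l m key rp rq sp sq.
have pr := rp; rewrite frobC in pr; have ps := sp; rewrite frobC in ps.
have qr := rq; rewrite frobC in qr; have qs := sq; rewrite frobC in qs.
rewrite !(frobDl, frobDr, frobNl, frobNr, frobZl, frobZr).
rewrite rp rq sp sq pr ps qr qs (frobC q p) (frobC s r).
(* By [key], the term -4 <m, l> equals 4 <p, q> + 4 <r, s>, after which the coefficients agree. *)
by lra.
Qed.

End FrobeniusBracket.

Theorem theorem2p7 (R : realType) (n : nat) (H : set 'M[R]_n)
    (closedH : closed_subgroup_GL H)
    (trH : forall A : 'M[R]_n, H A -> H A^T)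
    (u v : 'M[R]_n)
    (hu : lie_algebra H u) (hv : lie_algebra H v) :
  let u1 := sym_part u in
  let u2 := skew_part u in
  let v1 := sym_part v in
  let v2 := skew_part v in
  frob (curvature (lie_algebra H) u v v) u =
    - 2 * frob_norm (bracket u1 v1) ^+ 2
    + 4^-1 * frob_norm (bracket u v) ^+ 2
    + 2 * frob (bracket u1 v1) (bracket u2 v2).
Proof.
move=> u1 u2 v1 v2; rewrite !frob_norm_sqr.
pose g := lie_algebra H.
have gN x : g x -> g x^T by move=> gx; exact (lie_algebra_tr closedH trH gx).
have gbr x y : g x -> g y -> g (bracket x y).
  by move=> gx gy; exact (lie_algebra_bracket closedH gx gy).
have gB x y : g x -> g y -> g (x - y).
  by move=> gx gy; exact (lie_algebraB closedH gx gy).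
have gD x y : g x -> g y -> g (x + y).
  by move=> gx gy; exact (lie_algebraD closedH gx gy).
have gZ (c : R) x : g x -> g (c *: x) by exact (@lie_algebraZ R n H c x).
have gK x y : g x -> g y -> g (koszul x y).
  by move=> gx gy; apply: gZ; apply: gB; [apply: gD|]; apply: gbr => //; exact: gN.
have gu : g u by []. have gv : g v by [].
(* Only the closure properties of g matter from here on. *)
rewrite -/g; clearbody g.
have lcE x y : g x -> g y -> levi_civita g x y = koszul x y.
  by move=> gx gy; exact: levi_civitaE gB (gK _ _ gx gy).
(* Inner connections are replaced first, so that the outer arguments are visibly in g. *)
rewrite /curvature (lcE v v gv gv) (lcE u v gu gv) (lcE _ v (gbr _ _ gu gv) gv).
rewrite (lcE u _ gu (gK _ _ gv gv)) (lcE v _ gv (gK _ _ gu gv)).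
exact: curvature_koszul.
Qed.
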